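(* Let $\sigma\in\mathcal M([0,\tau])$ and $g\in L^2(-\tau,T;V)$. Choose a Borel strongly measurable representative of $g$ and extend it by zero to $\mathbb R$. Then the Bochner integral $$(\mathcal K_\sigma g)(t):=\int_{[0,\tau]}A_1g(t-s)\,d\sigma(s)$$ exists in $V^*$ for almost every $t\in(0,T)$ and defines an element of $L^2(0,T;V^* )$. Furthermore, $$\|\mathcal K_\sigma g\|_{L^2(0,T;V^* )}\le\Lambda_1\|\sigma\|_{\mathcal M([0,\tau])}\|g\|_{L^2(-\tau,T;V)}.$$ The element $\mathcal K_\sigma g\in L^2(0,T;V^* )$ is independent of the chosen Borel strongly measurable representative of $g$. More generally, it is unchanged under any modification of the (extended) function on a Lebesgue-null subset of $\mathbb R$, provided that the modified function remains Borel strongly measurable.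
   Context: $T>0$ and $\tau>0$ are fixed. $V$ is a real separable Hilbert space with dual $V^*$ (in the paper $V$ is part of a Gelfand triple $V\hookrightarrow H\cong H^*\hookrightarrow V^*$ with $H$ a real separable Hilbert space and the embedding $V\hookrightarrow H$ continuous and dense). $a_1:V\times V\to\mathbb R$ is a bilinear form with $|a_1(w,v)|\le\Lambda_1\|w\|_V\|v\|_V$ for all $w,v\in V$ and a constant $\Lambda_1>0$, and $A_1\in\mathcal L(V,V^* )$ is given by $\langle A_1w,v\rangle=a_1(w,v)$. $\mathcal M([0,\tau])$ is the Banach space of finite signed Borel measures on $[0,\tau]$ with $\|\sigma\|_{\mathcal M([0,\tau])}=|\sigma|([0,\tau])$. For a Banach space $X$ and a strongly $|\sigma|$-measurable $F:[0,\tau]\to X$ with $\int\|F\|_X\,d|\sigma|<\infty$, $\int F\,d\sigma:=\int F\,d\sigma^+-\int F\,d\sigma^-$ (Bochner integrals), where $\sigma=\sigma^+-\sigma^-$ is the Jordan decomposition. *)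

(* Defs.v *)
From HB Require Import structures.
From mathcomp Require Import all_boot all_order all_algebra.
From mathcomp Require Import all_classical all_reals all_analysis.
From mathcomp Require Import ring lra.

Set Implicit Arguments.
Unset Strict Implicit.
Unset Printing Implicit Defensive.

Import Order.TTheory GRing.Theory Num.Theory.
Import numFieldNormedType.Exports.

Local Open Scope classical_set_scope.
Local Open Scope ring_scope.

HB.mixin Record NormedModule_hasInnerProduct (R : realType) V
    & NormedModule R V := {
  iprod : V -> V -> R ;
  iprodC : forall x y, iprod x y = iprod y x ;
  iprodDl : forall x y z, iprod (x + y) z = iprod x z + iprod y z ;
  iprodZl : forall (a : R) x y, iprod (a *: x) y = a * iprod x y ;
  iprod_norm : forall x, iprod x x = `|x| ^+ 2
}.

#[short(type="hilbertType")]
HB.structure Definition Hilbert (R : realType) :=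
  {V of CompleteNormedModule R V & NormedModule_hasInnerProduct R V}.

Definition separable_space (X : topologicalType) :=
  exists2 D : set X, countable D & dense D.

(* The topological dual, normed by the operator norm. *)
Section dual_def.
Context (R : realType) (V : normedModType R).

Definition dual_pred : {pred V -> R} :=
  [pred f | `[< linear (f : V -> R) /\ continuous f >]].

Record tdual := Dual {
  dual_fun :> V -> R ;
  dual_funP : dual_fun \in dual_pred
}.

HB.instance Definition _ := [isSub for dual_fun].
HB.instance Definition _ := [Choice of tdual by <:].

Lemma dual_submod : submod_closed dual_pred.
Proof.
split=> [|k f h]; rewrite !inE.
  split=> [a x y /=|x]; last exact: cvg_cst.
  by rewrite /GRing.zero/= scaler0 addr0.
move=> [lf cf] [lh ch]; split => [a x y|x].
  have fhE z : (k *: f + h) z = k * f z + h z by [].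
  rewrite !fhE lf lh /GRing.scale/=; ring.
have -> : k *: f + h = (k \*: f) \+ h by [].
by apply: continuousD; [apply: cvgZl_tmp; exact: cf|exact: ch].
Qed.

HB.instance Definition _ :=
  GRing.isSubmodClosed.Build R _ dual_pred dual_submod.
HB.instance Definition _ := [SubChoice_isSubLmodule of tdual by <:].

Lemma dual_linear (f : tdual) : linear f.
Proof. by have := dual_funP f; rewrite inE => -[]. Qed.

Lemma dual_continuous (f : tdual) : continuous f.
Proof. by have := dual_funP f; rewrite inE => -[]. Qed.

HB.instance Definition _ (f : tdual) :=
  GRing.isLinear.Build R V R *:%R f (dual_linear f).

Lemma dual_eqP (f h : tdual) : f =1 h -> f = h.
Proof. by move=> fh; apply/val_inj/funext. Qed.

Lemma dual_addE (f h : tdual) x : (f + h) x = f x + h x.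
Proof. by []. Qed.

Lemma dual_oppE (f : tdual) x : (- f) x = - f x.
Proof. by []. Qed.

Lemma dual_scaleE (k : R) (f : tdual) x : (k *: f) x = k * f x.
Proof. by []. Qed.

Definition dual_norm (f : tdual) : R :=
  sup [set `|f x| | x in [set x : V | `|x| <= 1]].

Lemma dual_bounded (f : tdual) : exists2 M, 0 <= M & forall x, `|f x| <= M * `|x|.
Proof.
have /linear_bounded_continuous/linear_boundedP/pinfty_ex_gt0[M M0 fM] :=
  @dual_continuous f.
by exists M => //; exact: ltW.
Qed.

Lemma dual_norm_has_sup (f : tdual) :
  has_sup [set `|f x| | x in [set x : V | `|x| <= 1]].
Proof.
split; first by exists `|f 0|, 0 => //=; rewrite normr0.
have [M M0 fM] := dual_bounded f.
exists M => _ [x /= x1 <-].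
by rewrite (le_trans (fM x))// ler_piMr.
Qed.

Lemma dual_norm_le (f : tdual) (M : R) : 0 <= M ->
  (forall x, `|f x| <= M * `|x|) -> dual_norm f <= M.
Proof.
move=> M0 fM; apply: ge_sup; first exact: (dual_norm_has_sup f).1.
by move=> _ [x /= x1 <-]; rewrite (le_trans (fM x))// ler_piMr.
Qed.

Lemma dual_norm_ge0 (f : tdual) : 0 <= dual_norm f.
Proof.
apply: (le_trans (normr_ge0 (f 0))).
by apply: sup_upper_bound; [exact: dual_norm_has_sup|exists 0 => //=; rewrite normr0].
Qed.

Lemma dual_normP (f : tdual) x : `|f x| <= dual_norm f * `|x|.
Proof.
have [->|x0] := eqVneq x 0; first by rewrite linear0 !normr0 mulr0.
rewrite -ler_pdivrMr ?normr_gt0//.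
have -> : `|f x| / `|x| = `|f (`|x|^-1 *: x)|.
  by rewrite linearZ/= normrM ger0_norm ?invr_ge0// mulrC.
apply: sup_upper_bound; first exact: dual_norm_has_sup.
exists (`|x|^-1 *: x) => //=.
by rewrite normrZ ger0_norm ?invr_ge0// mulVf ?normr_eq0.
Qed.

Lemma dual_normD (f h : tdual) : dual_norm (f + h) <= dual_norm f + dual_norm h.
Proof.
apply: dual_norm_le; first by rewrite addr_ge0 ?dual_norm_ge0.
move=> x; rewrite dual_addE mulrDl (le_trans (ler_normD _ _))//.
by rewrite lerD// dual_normP.
Qed.

Lemma dual_normZ_le (k : R) (f : tdual) : dual_norm (k *: f) <= `|k| * dual_norm f.
Proof.
apply: dual_norm_le; first by rewrite mulr_ge0 ?dual_norm_ge0.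
by move=> x; rewrite dual_scaleE normrM -mulrA ler_wpM2l// dual_normP.
Qed.

Lemma dual_normZ (k : R) (f : tdual) : dual_norm (k *: f) = `|k| * dual_norm f.
Proof.
apply/eqP; rewrite eq_le dual_normZ_le/=.
have [->|k0] := eqVneq k 0; first by rewrite normr0 mul0r dual_norm_ge0.
rewrite -ler_pdivlMl ?normr_gt0// -normfV.
by rewrite (le_trans _ (dual_normZ_le _ _))// scalerA mulVf// scale1r.
Qed.

Lemma dual_norm_eq0 (f : tdual) : dual_norm f = 0 -> f = 0.
Proof.
move=> f0; apply: dual_eqP => x.
by apply/normr0_eq0/le_anti; rewrite normr_ge0 andbT -(mul0r `|x|) -f0 dual_normP.
Qed.

HB.instance Definition _ :=
  Lmodule_isNormed.Build R tdual dual_normD dual_normZ dual_norm_eq0.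

Lemma dual_normE (f : tdual) : `|f| = dual_norm f. Proof. by []. Qed.

Lemma dual_complete (F : set_system tdual) :
  ProperFilter F -> cauchy F -> cvg F.
Proof.
move=> FF Fc.
have Fex (e : R) : 0 < e -> exists f0 : tdual, F (ball f0 e).
  by move: e; exact/cauchyP.
have Fx x : cvg ((fun f : tdual => f x) @ F).
  apply: cauchy_cvg; apply: cauchy_exP => e e0.
  have x1 : 0 < `|x| + 1 by rewrite ltr_wpDl.
  have [f0 Ff0] := Fex (e / (`|x| + 1)) (divr_gt0 e0 x1).
  exists (f0 x).
  suff : F [set f : tdual | ball (f0 x) e (f x)] by [].
  apply: filterS Ff0 => f; rewrite -!ball_normE/= => f0f.
  rewrite (le_lt_trans (dual_normP (f0 - f) x))//.
  rewrite (@le_lt_trans _ _ (`|f0 - f| * (`|x| + 1)))//.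
    by rewrite ler_wpM2l ?dual_norm_ge0// lerDl.
  by rewrite -ltr_pdivlMr.
pose L x : R := lim ((fun f : tdual => f x) @ F).
have LE x : (fun f : tdual => f x) @ F --> L x by exact: Fx.
have Llin : linear L.
  move=> a x y; apply/cvg_lim => //.
  have -> : (fun f : tdual => f (a *: x + y)) =
      (fun f : tdual => a *: f x + f y) by apply/funext => f; rewrite linearP.
  by apply: cvgD; [apply: cvgZl_tmp; exact: LE|exact: LE].
have Lclose (e : R) (f0 : tdual) : F (ball f0 e) -> forall x, `|L x - f0 x| <= e * `|x|.
  move=> Ff0 x; apply/ler_addgt0Pr => d d0.
  have /cvgrPdist_lt/(_ _ d0) FL := LE x.
  have [f [Lf]] := filter_ex (filterI FL Ff0).
  rewrite -ball_normE/= => f0f.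
  rewrite -(subrKA (f x)) (le_trans (ler_normD _ _))// addrC.
  rewrite lerD ?(ltW Lf)// distrC.
  apply: le_trans (dual_normP (f0 - f) x) _.
  by rewrite ler_wpM2r// ltW.
have Lcont : continuous L.
  have [f1 Ff1] := Fex 1 ltr01.
  pose Llm : {linear V -> R} :=
    HB.pack L (GRing.isLinear.Build R V R *:%R L Llin).
  apply/(linear_bounded_continuous Llm)/linear_boundedP.
  have [M M0 fM] := dual_bounded f1.
  near=> r => x; rewrite (@le_trans _ _ ((1 + M) * `|x|))//.
    rewrite -[Llm x]/(L x) -(subrK (f1 x) (L x)).
    by rewrite (le_trans (ler_normD _ _))// mulrDl lerD// Lclose.
  by rewrite ler_wpM2r//; near: r; apply: nbhs_pinfty_ge; rewrite num_real.
have LP : L \in dual_pred by rewrite inE.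
apply/cvg_ex; exists (Dual LP).
apply/cvgrPdist_le => e e0.
have e2 : 0 < e / 2 by rewrite divr_gt0.
have [f0 Ff0] := Fex _ e2.
apply: filterS (Ff0) => f; rewrite -ball_normE/= => f0f; rewrite dual_normE.
have -> : Dual LP - f = (Dual LP - f0) + (f0 - f) by rewrite subrKA.
rewrite [leRHS](splitr e) (le_trans (dual_normD _ _))// lerD// ?(ltW f0f)//.
by apply: dual_norm_le => [|x]; [exact: ltW|exact: Lclose].
Unshelve. all: by end_near. Qed.

HB.instance Definition _ := Uniform_isComplete.Build tdual dual_complete.

End dual_def.

Section form_operator.
Context (R : realType) (V : normedModType R).
Variables (a : {biscalar V}) (L : R).
Hypothesis aL : forall w v, `|a w v| <= L * `|w| * `|v|.

Lemma form_op_dual w : (a w : V -> R) \in @dual_pred R V.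
Proof.
rewrite inE; split; first by move=> k x y; rewrite linearPr.
have aw_linear : linear (a w : V -> R) by move=> k x y; rewrite linearPr.
pose aw : {linear V -> R} :=
  HB.pack (a w : V -> R) (GRing.isLinear.Build R V R *:%R _ aw_linear).
apply/(linear_bounded_continuous aw)/linear_boundedP.
near=> r => x; apply: le_trans (aL w x) _.
by rewrite ler_wpM2r//; near: r; apply: nbhs_pinfty_ge; rewrite num_real.
Unshelve. all: by end_near. Qed.

Definition form_op (w : V) : tdual V := Dual (form_op_dual w).

Lemma form_opE w v : form_op w v = a w v. Proof. by []. Qed.

Lemma form_op_linear : linear form_op.
Proof. by move=> k x y; apply: dual_eqP => v; rewrite form_opE linearPl. Qed.

Lemma form_op_norm w : 0 <= L -> `|form_op w| <= L * `|w|.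
Proof. by move=> L0; apply: dual_norm_le => [|v]; [rewrite mulr_ge0|exact: aL]. Qed.

End form_operator.

Section jordan.
Context d (T : measurableType d) (R : realType).
Variable nu : {charge set T -> \bar R}.

(* An arbitrary Hahn decomposition; the Jordan decomposition built from it does
   not depend on this choice. *)
Definition hahn_pos : set T := projT1 (cid (Hahn_decomposition nu)).

Definition hahn_neg : set T := projT1 (cid (projT2 (cid (Hahn_decomposition nu)))).

Lemma hahn_posneg : hahn_decomposition nu hahn_pos hahn_neg.
Proof. exact: projT2 (cid (projT2 (cid (Hahn_decomposition nu)))). Qed.

Definition charge_pos : {measure set T -> \bar R} := jordan_pos hahn_posneg.

Definition charge_neg : {measure set T -> \bar R} := jordan_neg hahn_posneg.

Definition charge_abs : {measure set T -> \bar R} := charge_variation hahn_posneg.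

End jordan.

Section bochner.
Context d (T : measurableType d) (R : realType) (X : normedModType R).
Implicit Types (mu : {measure set T -> \bar R}) (F : T -> X) (s : T -> X).

Definition simple_fun s :=
  finite_set (range s) /\ forall y, measurable (s @^-1` [set y]).

(* Everywhere pointwise limits (on D) of simple functions: no measure involved. *)
Definition strongly_measurable (D : set T) F :=
  exists s_ : nat -> T -> X, (forall n, simple_fun (s_ n)) /\
    forall x, D x -> s_ n x @[n --> \oo] --> F x.

Definition ae_strongly_measurable mu F :=
  exists s_ : nat -> T -> X, (forall n, simple_fun (s_ n)) /\
    {ae mu, forall x, s_ n x @[n --> \oo] --> F x}.

(* The library's integral of a nonnegative function is the supremum over its
   measurable simple minorants, so the norm of an almost everywhere limit of
   simple functions is integrated as for the completed measure. *)
Definition bochner_integrable mu F :=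
  ae_strongly_measurable mu F /\ (\int[mu]_x (`|F x|)%:E < +oo)%E.

(* For an integrable s only the fibre over 0 can have infinite measure, and
   there the junk value of fine is multiplied by 0. *)
Definition simple_integral mu s : X :=
  \sum_(y \in range s) fine (mu (s @^-1` [set y])) *: y.

Definition is_bochner_integral mu F (I : X) :=
  bochner_integrable mu F /\
  exists s_ : nat -> T -> X,
    [/\ forall n, simple_fun (s_ n),
        forall n, (\int[mu]_x (`|s_ n x|)%:E < +oo)%E,
        (\int[mu]_x (`|F x - s_ n x|)%:E)%E @[n --> \oo] --> 0%E &
        simple_integral mu (s_ n) @[n --> \oo] --> I].

Definition is_charge_bochner_integral (nu : {charge set T -> \bar R}) F (I : X) :=
  bochner_integrable (charge_abs nu) F /\
  exists Ip In, [/\ is_bochner_integral (charge_pos nu) F Ip,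
    is_bochner_integral (charge_neg nu) F In & I = Ip - In].

(* 0 when the integral does not exist *)
Definition charge_bochner_integral (nu : {charge set T -> \bar R}) F : X :=
  xget 0 (is_charge_bochner_integral nu F).

Definition L2norm mu F : \bar R := ('N[mu]_2%:E[EFin \o (fun x => `|F x|%R)])%E.

Definition bochner_L2 mu F :=
  ae_strongly_measurable mu F /\ (L2norm mu F < +oo)%E.

End bochner.

(* The interval [0, tau] with its Borel subsets; tau_gt0 makes it nonempty. *)
Definition delay_itv (R : realType) (tau : R) (tau_gt0 : 0 < tau) : Type :=
  set_type `[0, tau]%classic.

Section delay_itv_measurable.
Context (R : realType) (tau : R) (tau_gt0 : 0 < tau).
Local Notation I := (delay_itv tau_gt0).

Definition delay_val (s : I) : R := \val s.

HB.instance Definition _ := Choice.copy I (set_type `[0, tau]%classic).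

Lemma delay_itv0 : 0 \in `[0, tau]%classic.
Proof. by rewrite inE /= in_itv /= lexx ltW. Qed.

HB.instance Definition _ :=
  isPointed.Build I (exist _ 0 delay_itv0 : set_type `[0, tau]%classic).

HB.instance Definition _ := Measurable.copy I
  (g_sigma_algebra_preimageType delay_val).

End delay_itv_measurable.

(* Lebesgue measure on ]a, b[, as a measure on R carried by ]a, b[. *)
Definition lebesgue_itv (R : realType) (a b : R) :
    {measure set (measurableTypeR R) -> \bar R} :=
  mrestr lebesgue_measure (measurable_itv `]a, b[).

Definition borel_representative (R : realType) (X : normedModType R) (a b : R)
    (g h : R -> X) :=
  strongly_measurable `]a, b[ h /\ h = g %[ae lebesgue_itv a b].

(* Not the library's f \_ D, whose value off D is point rather than 0. *)
Definition zero_ext (R : realType) (X : normedModType R) (a b : R) (h : R -> X) :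
  R -> X := patch (fun=> 0) `]a, b[%classic h.

Section delay_convolution.
Context (R : realType) (X Y : normedModType R) (tau : R) (tau_gt0 : 0 < tau).
Variables (A : X -> Y) (sigma : {charge set (delay_itv tau_gt0) -> \bar R}).

Definition delay_integrand (g : R -> X) (t : R) (s : delay_itv tau_gt0) : Y :=
  A (g (t - delay_val s)).

Definition delay_conv_exists (g : R -> X) (t : R) :=
  exists I, is_charge_bochner_integral sigma (delay_integrand g t) I.

Definition delay_conv (g : R -> X) (t : R) : Y :=
  charge_bochner_integral sigma (delay_integrand g t).

End delay_convolution.

(* Main.v *)
Require Import Defs.
From HB Require Import structures.
From mathcomp Require Import all_boot all_order all_algebra finmap.
From mathcomp Require Import all_classical all_reals all_analysis.
From mathcomp Require Import measurable_realfun.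

Set Implicit Arguments.
Unset Strict Implicit.
Unset Printing Implicit Defensive.

Import Order.TTheory GRing.Theory Num.Theory.
Import numFieldNormedType.Exports.

Local Open Scope classical_set_scope.
Local Open Scope ring_scope.

(* Let G be the representative extended by zero and
   phi(t) = \int |G(t - s)| d|sigma|(s).  By Cauchy-Schwarz in s, Tonelli and
   translation invariance of Lebesgue measure,
   \int phi^2 <= |sigma|([0, tau])^2 \int |G|^2 over the whole line, so phi is
   finite almost everywhere and the Bochner integral defining K G exists there,
   with |K G| <= Lambda1 phi.  The same estimate applied to the difference of
   two functions equal almost everywhere gives the independence of the
   representative.  For simple G, K G is a finite sum of fixed vectors with
   bounded measurable scalar coefficients, which can be rounded to simple
   functions with a uniform error; approximating G pointwise by simple functions
   bounded by |G| + 1 then exhibits K G as an almost everywhere limit of simple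
   functions. *)

(** * Monotonicity of almost everywhere statements *)

Section almost_everywhere.
Context d (T : measurableType d) (R : realType) (mu : {measure set T -> \bar R}).
Implicit Types P Q S : T -> Prop.

Lemma aeS P Q : (forall x, P x -> Q x) ->
  {ae mu, forall x, P x} -> {ae mu, forall x, Q x}.
Proof. by move=> PQ; apply: filterS. Qed.

Lemma aeS2 P Q S : (forall x, P x -> Q x -> S x) ->
  {ae mu, forall x, P x} -> {ae mu, forall x, Q x} -> {ae mu, forall x, S x}.
Proof. by move=> PQ; apply: filterS2. Qed.

End almost_everywhere.

(** * Integrals of nonnegative functions, measurable or not *)

Section lower_integral.
Context d (T : measurableType d) (R : realType).
Implicit Types (mu : {measure set T -> \bar R}) (f g : T -> \bar R).
Local Open Scope ereal_scope.
Import HBNNSimple.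

(* No measurability: the integral of a nonnegative function is the supremum of
   the integrals of its simple minorants, and a simple minorant of f that is
   cut off on a measurable null set is a minorant of g. *)
Lemma ae_ge0_le_integralT mu f g : (forall x, 0 <= f x) -> (forall x, 0 <= g x) ->
  {ae mu, forall x, f x <= g x} -> \int[mu]_x f x <= \int[mu]_x g x.
Proof.
move=> f0 g0 [N [mN N0 fgN]].
rewrite !ge0_integralTE//; apply: ge_ereal_sup => _ [h hf <-].
have mNC : measurable (~` N) by exact: measurableC.
pose h' := proj_nnsfun h mNC.
have -> : sintegral mu h = sintegral mu h'.
  rewrite -!integralT_nnsfun; apply: ge0_ae_eq_integral => //.
  - exact/measurable_EFinP.
  - exact/measurable_EFinP.
  - by move=> x _; rewrite lee_fin.
  - by move=> x _; rewrite lee_fin.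
  exists N; split=> // x /=; apply: contra_notP => Nx _.
  by rewrite /h' /proj_nnsfun/= mindicE mem_set// mulr1.
apply: ereal_sup_ubound; exists h' => //= x.
rewrite /h' /proj_nnsfun/= mindicE; have [xN|xN] := boolP (x \in ~` N).
  rewrite mulr1 (le_trans (hf x))//; move: xN; rewrite inE/= => xN.
  by apply: contrapT => fg; exact/xN/fgN.
by rewrite mulr0.
Qed.

Lemma ge0_le_integralT mu f g : (forall x, 0 <= f x) ->
  (forall x, f x <= g x) -> \int[mu]_x f x <= \int[mu]_x g x.
Proof.
move=> f0 fg; apply: ae_ge0_le_integralT => //; last exact/aeW.
by move=> x; exact: le_trans (fg x).
Qed.

Lemma ae_ge0_eq_integralT mu f g : (forall x, 0 <= f x) -> (forall x, 0 <= g x) ->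
  {ae mu, forall x, f x = g x} -> \int[mu]_x f x = \int[mu]_x g x.
Proof.
move=> f0 g0 fg; apply/le_anti/andP; split; apply: ae_ge0_le_integralT => //;
  by apply: aeS fg => x ->.
Qed.

(** Both integrals are suprema over the same simple minorants. This lets the estimate of [K G] on
    the whole line be restricted to an interval without first proving that its norm is Borel
    measurable. *)
Lemma le_measure_ge0_integralT (m1 m2 : {measure set T -> \bar R}) f :
  (forall S, measurable S -> m1 S <= m2 S) -> (forall x, 0 <= f x) ->
  \int[m1]_x f x <= \int[m2]_x f x.
Proof.
move=> m12 f0; rewrite !ge0_integralTE//; apply: ge_ereal_sup => _ [h hf <-].
apply: (le_trans (le_measure_sintegral m12 h)).
by apply: ereal_sup_ubound; exists h.
Qed.

End lower_integral.

(** * Maps with finite range and measurable fibres *)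

Section simple_map.
Context d (T : measurableType d).

(* [simple_fun] for an arbitrary codomain, so that pairs of simple functions
   are covered. *)
Definition simple_map (Y : Type) (p : T -> Y) :=
  finite_set (range p) /\ forall y, measurable (p @^-1` [set y]).

(** The fibre over w is the finite union of the intersections of a fibre of p over y and a fibre of
    q over z, for the pairs with [h y z = w]. *)
Lemma simple_map_op2 (Y Z W : Type) (h : Y -> Z -> W) (p : T -> Y) (q : T -> Z) :
  simple_map p -> simple_map q -> simple_map (fun x => h (p x) (q x)).
Proof.
move=> [fp mp] [fq mq]; split.
  apply: sub_finite_set (finite_image2 h fp fq) => _ [x _ <-].
  by exists (p x); [exists x|exists (q x); [exists x|]].
move=> w.
have -> : (fun x => h (p x) (q x)) @^-1` [set w] =
    \bigcup_(y in range p) \bigcup_(z in range q `&` [set z | h y z = w])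
      (p @^-1` [set y] `&` q @^-1` [set z]).
  apply/seteqP; split=> x /=.
    by move=> hw; exists (p x); [exists x|exists (q x); split=> //; exists x].
  by move=> [y _ [z [_ <-]] [/= -> ->]].
apply: fin_bigcup_measurable => // y _.
apply: fin_bigcup_measurable => [|z _]; first exact: finite_setIl.
exact: measurableI.
Qed.

Lemma simple_map_comp (Y Z : Type) (h : Y -> Z) (p : T -> Y) :
  simple_map p -> simple_map (h \o p).
Proof. by move=> sp; exact: (simple_map_op2 (fun y _ => h y) sp sp). Qed.

(** Composing p with the predicate B gives a simple map into [Prop], and the preimage of B is its
    fibre over [True]; B is therefore arbitrary. *)
Lemma simple_map_preimage (Y : Type) (p : T -> Y) B :
  simple_map p -> measurable (p @^-1` B).
Proof.
move=> /(simple_map_comp B)[_ mB]; have := mB True; congr measurable.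
by apply/seteqP; split=> x /=; [move=> ->|move=> Bx; exact/propext].
Qed.

Lemma simple_map_measurable d' (Y : sigmaRingType d') (p : T -> Y) :
  simple_map p -> measurable_fun setT p.
Proof. by move=> sp _ B _; rewrite setTI; exact: simple_map_preimage. Qed.

Lemma simple_map_cst (Y : Type) (y : Y) : simple_map (fun=> y : Y).
Proof.
split; first by apply: sub_finite_set (finite_set1 y) => _ [x _ <-].
move=> z; have [->|yz] := pselect (y = z).
  by rewrite (_ : _ @^-1` _ = setT)//; apply/seteqP; split.
by rewrite (_ : _ @^-1` _ = set0)//; apply/seteqP; split.
Qed.

(** The patched map combines p with the boolean membership test of D, which is itself simple. *)
Lemma simple_map_patch (Y : Type) (y : Y) D (p : T -> Y) : measurable D ->
  simple_map p -> simple_map (patch (fun=> y) D p).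
Proof.
move=> mD sp; have sD : simple_map (fun x => x \in D).
  split; first exact: finite_finset.
  move=> [].
    by rewrite (_ : _ @^-1` _ = D)//; apply/seteqP; split=> x /=;
      [exact: set_mem|exact: mem_set].
  rewrite (_ : _ @^-1` _ = ~` D); first exact: measurableC.
  by apply/seteqP; split=> x /=; 
    [move=> /negbT; rewrite notin_setE|move=> xD; exact: memNset].
exact: (simple_map_op2 (fun b z => if b then z else y) sD sp).
Qed.

Lemma simple_map_sum (M : nmodType) (I : Type) (r : seq I) (p : I -> T -> M) :
  (forall i, simple_map (p i)) -> simple_map (fun x => \sum_(i <- r) p i x).
Proof.
move=> sp; elim: r => [|i r ih].
  by under eq_fun do rewrite big_nil; exact: simple_map_cst.
by under eq_fun do rewrite big_cons; exact: (simple_map_op2 +%R (sp i) ih).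
Qed.

End simple_map.

Lemma simple_map_precomp d d' (S : measurableType d) (T : measurableType d')
    (Y : Type) (p : T -> Y) (u : S -> T) :
  measurable_fun setT u -> simple_map p -> simple_map (p \o u).
Proof.
move=> mu sp; split.
  by apply: sub_finite_set sp.1 => _ [x _ <-]; exists (u x).
by move=> y; rewrite -[X in measurable X]setTI; exact: (mu measurableT _ (sp.2 y)).
Qed.

Lemma simple_map_fset d (T : measurableType d) (Y : choiceType) (p : T -> Y) :
  simple_map p -> forall x, p x \in fset_set (range p).
Proof. by move=> [fp _] x; rewrite in_fset_set//; apply/mem_set; exists x. Qed.

(** * Integrals of simple functions *)

Section simple_integral.
Context d (T : measurableType d) (R : realType) (mu : {measure set T -> \bar R}).

(** Finite additivity over the fibres; r may exceed the range of p, the additional fibres being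
    empty. *)
Lemma measure_simple_map (Y : choiceType) (p : T -> Y) (r : {fset Y}) (P : pred Y) :
  simple_map p -> (forall x, p x \in r) ->
  mu (p @^-1` [set y | P y]) = \sum_(y <- r | P y) mu (p @^-1` [set y]).
Proof.
move=> [_ mp] pr; rewrite -big_filter.
have ur : uniq [seq y <- r | P y] by rewrite filter_uniq.
rewrite fsbig_seq//.
rewrite -measure_fsbig//; first last.
  exact: trivIset_preimage1.
congr (mu _); rewrite -fsbig_seq// -bigcup_seq.
apply/seteqP; split=> x /=.
  by move=> Px; exists (p x) => //=; rewrite mem_filter Px pr.
by move=> [y /=]; rewrite mem_filter => /andP[Py _] ->.
Qed.

Hypothesis mufin : fin_num_fun mu.

(** The sum runs over the fibres of p instead of those of [h \o p], grouped by the value of h. Two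
    simple functions can thus be integrated over one common partition. *)
Lemma simple_integral_comp (X : normedModType R) (Y : choiceType) (p : T -> Y)
    (r : {fset Y}) (h : Y -> X) : simple_map p -> (forall x, p x \in r) ->
  simple_integral mu (h \o p) = \sum_(y <- r) fine (mu (p @^-1` [set y])) *: h y.
Proof.
move=> sp pr; pose hr := [fset h y | y in r]%fset.
rewrite /simple_integral (@fsbig_fwiden _ _ _ _ hr)//=; last 2 first.
- by move=> _ [x _ <-] /=; apply/imfsetP; exists (p x) => //=; exact: pr.
- move=> z [_ /= zp]; rewrite (_ : _ @^-1` _ = set0) ?measure0 ?scale0r//.
  by apply/seteqP; split=> x //= hx; apply: zp; exists x.
rewrite [RHS](partition_big_imfset _ h)/=; apply: eq_bigr => z _.
rewrite (_ : _ @^-1` _ = p @^-1` [set y | h y == z]); last first.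
  by apply/seteqP; split=> x /= /eqP.
rewrite (measure_simple_map _ sp pr) -sum_fine => [|y _]; last first.
  by apply: mufin; exact: sp.2.
by rewrite scaler_suml; apply: eq_bigr => y /eqP ->.
Qed.

Lemma integral_simple_map (Y : choiceType) (p : T -> Y) (r : {fset Y}) (h : Y -> R) :
  simple_map p -> (forall x, p x \in r) -> (forall y, 0 <= h y) ->
  (\int[mu]_x (h (p x))%:E = \sum_(y <- r) (h y)%:E * mu (p @^-1` [set y]))%E.
Proof.
move=> [_ mp] pr h0.
transitivity (\int[mu]_x \sum_(y <- r) ((h y)%:E * (\1_(p @^-1` [set y]) x)%:E))%E.
  (* Only the term y = p x survives. *)
  apply: eq_integral => x _; rewrite (big_fsetD1 (p x))//= indicE mem_set// mule1.
  rewrite big_seq big1 ?adde0// => y; rewrite !inE => /andP[yp _].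
  by rewrite indicE memNset ?mule0//= => /esym/eqP; exact/negP.
rewrite ge0_integral_sum//; last 2 first.
- by move=> y; apply: measurable_funeM; exact/measurable_EFinP/measurable_indic.
- by move=> y x _; rewrite mule_ge0 ?lee_fin.
apply: eq_bigr => y _; rewrite ge0_integralZl//.
- by rewrite integral_indic// setIT.
- exact/measurable_EFinP/measurable_indic.
- by rewrite lee_fin.
Qed.

(** Over the fibres of the pair (s1, s2) both integrals become sums with the same weights, and the
    bound is the triangle inequality. *)
Lemma simple_integral_dist_le (X : normedModType R) (s1 s2 : T -> X) :
  simple_fun s1 -> simple_fun s2 ->
  (`|simple_integral mu s1 - simple_integral mu s2|%:E <=
   \int[mu]_x `|s1 x - s2 x|%:E)%E.
Proof.
move=> ss1 ss2; pose p x := (s1 x, s2 x).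
have sp : simple_map p := simple_map_op2 pair ss1 ss2.
pose r := fset_set (range p).
have pr : forall x, p x \in r := simple_map_fset sp.
rewrite (simple_integral_comp (fun y => y.1) sp pr).
rewrite (simple_integral_comp (fun y => y.2) sp pr).
rewrite (integral_simple_map (h := fun y => `|y.1 - y.2|) sp pr)//.
rewrite -sumrB; under eq_bigr do rewrite -scalerBr.
under [leRHS]eq_bigr => y _ do
  rewrite -(fineK (mufin (sp.2 y))) -EFinM.
rewrite sumEFin lee_fin (le_trans (ler_norm_sum _ _ _))//.
apply: ler_sum => y _; rewrite normrZ ger0_norm 1?mulrC// fine_ge0.
Qed.

Lemma simple_fun_integral_lty (X : normedModType R) (s : T -> X) :
  simple_fun s -> (\int[mu]_x `|s x|%:E < +oo)%E.
Proof.
move=> ss; pose r := fset_set (range s).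
have sr : forall x, s x \in r := simple_map_fset ss.
rewrite (integral_simple_map (h := fun y => `|y|) ss sr)//.
under eq_bigr => y _ do rewrite -(fineK (mufin (ss.2 y))) -EFinM.
by rewrite sumEFin ltry.
Qed.

End simple_integral.

(** * Stability of strong measurability and dominated simple approximation *)

Section strong_measurability.
Context d (T : measurableType d) (R : realType).
Implicit Types X Y : normedModType R.

Lemma strongly_measurable_precomp d' (S : measurableType d') X (F : T -> X)
    (u : S -> T) : measurable_fun setT u ->
  strongly_measurable setT F -> strongly_measurable setT (F \o u).
Proof.
move=> mu [s_ [ss sF]]; exists (fun n => s_ n \o u); split=> [n|x _].
  exact: simple_map_precomp (ss n).
exact: sF.
Qed.

Lemma strongly_measurable_comp X Y (h : X -> Y) (F : T -> X) :
  continuous h -> strongly_measurable setT F -> strongly_measurable setT (h \o F).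
Proof.
move=> ch [s_ [ss sF]]; exists (fun n => h \o s_ n); split=> [n|x _].
  exact: simple_map_comp (ss n).
by apply: (continuous_cvg _ (ch _)); exact: sF.
Qed.

Lemma simple_strongly_measurable X (s : T -> X) :
  simple_fun s -> strongly_measurable setT s.
Proof. by move=> ss; exists (fun=> s); split=> // x _; exact: cvg_cst. Qed.

Lemma strongly_measurableB X (F G : T -> X) :
  strongly_measurable setT F -> strongly_measurable setT G ->
  strongly_measurable setT (fun x => F x - G x).
Proof.
move=> [s_ [ss sF]] [t_ [st tG]].
exists (fun n x => s_ n x - t_ n x); split=> [n|x _].
  exact: (simple_map_op2 (fun y z => y - z) (ss n) (st n)).
by apply: cvgB; [exact: sF|exact: tG].
Qed.

Lemma strongly_measurable_norm X (F : T -> X) :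
  strongly_measurable setT F -> measurable_fun setT (fun x => `|F x|).
Proof.
move=> [s_ [ss sF]].
apply: (@measurable_fun_cvg _ _ _ _ (fun n x => `|s_ n x|)) => [n|x _].
  exact: simple_map_measurable (simple_map_comp Num.norm (ss n)).
by apply: cvg_norm; exact: sF.
Qed.

Lemma strongly_measurable_patch X D (F : T -> X) : measurable D ->
  strongly_measurable D F -> strongly_measurable setT (patch (fun=> 0) D F).
Proof.
move=> mD [s_ [ss sF]].
exists (fun n => patch (fun=> 0) D (s_ n)); split=> [n|x _].
  exact: (simple_map_patch 0 mD (ss n)).
by rewrite /patch; case: ifPn => [/set_mem/sF//|_]; exact: cvg_cst.
Qed.

(** Each [s_ n] is replaced by 0 where its norm exceeds |F| + 1. The limit is preserved: |s_n x|
    tends to |F x| < |F x| + 1, so at each x the cut-off is eventually inactive. *)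
Lemma strongly_measurable_approx X (F : T -> X) : strongly_measurable setT F ->
  exists s_ : nat -> T -> X, [/\ forall n, simple_fun (s_ n),
    forall n x, `|s_ n x| <= `|F x| + 1 &
    forall x, s_ n x @[n --> \oo] --> F x].
Proof.
move=> mF; have [s_ [ss sF]] := mF.
pose D n := [set x | `|s_ n x| <= `|F x| + 1].
exists (fun n => patch (fun=> 0) (D n) (s_ n)); split=> [n|n x|x].
- apply: (simple_map_patch 0 _ (ss n)).
  rewrite -[D n]setTI; apply: measurable_fun_le => //.
    exact: simple_map_measurable (simple_map_comp Num.norm (ss n)).
  by apply: measurable_funD => //; exact: strongly_measurable_norm.
- by rewrite /patch; case: ifPn => [/set_mem//|_]; rewrite normr0 addr_ge0.
- apply: cvg_trans (sF x Logic.I); apply: near_eq_cvg; near=> n.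
  rewrite /patch mem_set//=; apply: ltW; near: n.
  have /cvgr_lt : `|s_ n x| @[n --> \oo] --> `|F x| by apply: cvg_norm; exact: sF.
  by apply; rewrite ltrDl.
Unshelve. all: by end_near. Qed.

End strong_measurability.

(** * The Bochner integral against a finite measure *)

Section bochner_integral.
Context d (T : measurableType d) (R : realType).
Variable mu : {finite_measure set T -> \bar R}.

Lemma strongly_measurable_dist (X : normedModType R) (F G : T -> X) :
  strongly_measurable setT F -> strongly_measurable setT G ->
  measurable_fun setT (fun x => `|F x - G x|%:E).
Proof.
move=> mF mG; apply/measurable_EFinP.
exact: strongly_measurable_norm (strongly_measurableB mF mG).
Qed.

(** Dominated convergence with majorant 2|F| + 1, which is integrable because the measure is
    finite. *)
Lemma dist_integral_cvg0 (X : normedModType R) (F : T -> X) (s_ : nat -> T -> X) :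
  strongly_measurable setT F -> (\int[mu]_x `|F x|%:E < +oo)%E ->
  (forall n, strongly_measurable setT (s_ n)) ->
  (forall n x, `|s_ n x| <= `|F x| + 1) ->
  (forall x, s_ n x @[n --> \oo] --> F x) ->
  (\int[mu]_x `|F x - s_ n x|%:E)%E @[n --> \oo] --> 0%E.
Proof.
move=> mF iF ms sF1 sF.
have iF' : mu.-integrable setT (fun x => `|F x|%:E).
  apply/integrableP; split; first exact/measurable_EFinP/strongly_measurable_norm.
  by under eq_integral do rewrite gee0_abs ?lee_fin//.
have i1 : mu.-integrable setT (EFin \o cst (1 : R)).
  exact: finite_measure_integrable_cst.
have [|||||_ _] := @dominated_convergence _ _ _ mu setT measurableT
  (fun n x => `|F x - s_ n x|%:E) (cst 0%E)
  (fun x => `|F x|%:E + (`|F x|%:E + 1%:E))%E.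
- by move=> n; exact: strongly_measurable_dist.
- exact: measurable_cst.
- apply/aeW => x _; apply/cvg_EFin; first exact/nearW.
  rewrite -(normr0 X) -(subrr (F x)); apply: cvg_norm.
  by apply: cvgB; [exact: cvg_cst|exact: sF].
- by apply: integrableD => //; exact: integrableD.
- apply/aeW => x n _; rewrite gee0_abs ?lee_fin// (le_trans (ler_normB _ _))//.
  by rewrite lerD2l.
by rewrite integral0.
Qed.

(** The integrals of the simple approximations are no farther apart than the approximations are in
    $L^1$, hence form a Cauchy sequence; completeness of X supplies the limit. *)
Lemma bochner_integral_exists (X : completeNormedModType R) (F : T -> X) :
  strongly_measurable setT F -> (\int[mu]_x `|F x|%:E < +oo)%E ->
  exists I, is_bochner_integral mu F I.
Proof.
move=> mF iF; have [s_ [ss sF1 sF]] := strongly_measurable_approx mF.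
have ms n := simple_strongly_measurable (ss n).
have sL1 := dist_integral_cvg0 mF iF ms sF1 sF.
suff /cvg_ex[I sI] : cvg (simple_integral mu (s_ n) @[n --> \oo]).
  exists I; split; last by exists s_; split=> // n; exact: simple_fun_integral_lty.
  split=> //; exists s_; split=> //; exact/aeW.
apply: cauchy_cvg; apply: cauchy_exP => e e0.
have e20 : (0 < (e / 2)%:E)%E by rewrite lte_fin divr_gt0.
have [N _ FsN] := sL1 _ (open_ereal_lt' e20).
exists (simple_integral mu (s_ N)); exists N => // n /= Nn.
rewrite -ball_normE/= -lte_fin.
apply: le_lt_trans (simple_integral_dist_le (fin_num_measure mu) (ss N) (ss n)) _.
(* The $L^1$ distances from F to [s_ N] and from F to [s_ n] are each below e / 2. *)
rewrite [e]splitr EFinD.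
apply: le_lt_trans (lteD (FsN N (leqnn N)) (FsN n Nn)).
rewrite -ge0_integralD//; try exact: strongly_measurable_dist.
apply: ge0_le_integralT => [x|x]; rewrite ?lee_fin//.
by rewrite -(subrKA (F x)) (le_trans (ler_normD _ _))// distrC.
Qed.

(** The estimate for simple functions passes to the limit. With F = G it also gives uniqueness of
    the integral. *)
Lemma bochner_integral_dist_le (X : normedModType R) (F G : T -> X) (I J : X) :
  strongly_measurable setT F -> strongly_measurable setT G ->
  is_bochner_integral mu F I -> is_bochner_integral mu G J ->
  (`|I - J|%:E <= \int[mu]_x `|F x - G x|%:E)%E.
Proof.
move=> mF mG [_ [s_ [ss _ sF sI]]] [_ [t_ [st _ tG tJ]]].
have ms n := simple_strongly_measurable (ss n).
have mt n := simple_strongly_measurable (st n).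
apply: (@lee_cvg_to _ \oo _ _
  (fun n => `|simple_integral mu (s_ n) - simple_integral mu (t_ n)|%:E)
  (fun n => \int[mu]_x `|F x - s_ n x|%:E + (\int[mu]_x `|F x - G x|%:E +
            \int[mu]_x `|G x - t_ n x|%:E))%E).
- apply/cvg_EFin; first exact/nearW.
  by apply: cvg_norm; exact: cvgB.
- rewrite -[X in _ --> X]add0e; apply: cvgeD => //.
  rewrite -[X in _ --> X]adde0; apply: cvgeD => //; last exact: cvg_cst.
  by rewrite fin_num_adde_defl.
apply/nearW => n.
apply: le_trans (simple_integral_dist_le (fin_num_measure mu) (ss n) (st n)) _.
rewrite -!ge0_integralD//; try exact: strongly_measurable_dist.
- apply: ge0_le_integralT => x; first by rewrite lee_fin.
  rewrite -!EFinD lee_fin.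
  rewrite -(subrKA (F x)) (le_trans (ler_normD _ _))// distrC lerD2l.
  by rewrite -(subrKA (G x)) ler_normD.
- by move=> x _; rewrite -EFinD lee_fin addr_ge0.
- by apply: emeasurable_funD; exact: strongly_measurable_dist.
Qed.

Lemma simple_bochner_integral (X : normedModType R) (s : T -> X) :
  simple_fun s -> is_bochner_integral mu s (simple_integral mu s).
Proof.
move=> ss; have sfin := simple_fun_integral_lty (fin_num_measure mu) ss.
split; first by split=> //; exists (fun=> s); split=> //; apply/aeW => x; exact: cvg_cst.
exists (fun=> s); split=> //; last exact: cvg_cst.
under eq_fun do under eq_integral do rewrite subrr normr0.
by rewrite integral0; exact: cvg_cst.
Qed.

End bochner_integral.

(** * Finiteness of the variation and Bochner integrals against a charge *)

Section charge_variation_finite.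
Context d (T : measurableType d) (R : realType) (nu : {charge set T -> \bar R}).
Context P N (nuPN : hahn_decomposition nu P N).

Let charge_variation_fin : fin_num_fun (charge_variation nuPN).
Proof. by move=> A mA; rewrite fin_numD !fin_num_measure. Qed.

HB.instance Definition _ :=
  @Measure_isFinite.Build _ T R (charge_variation nuPN) charge_variation_fin.

End charge_variation_finite.

Section charge_bochner_integral.
Context d (T : measurableType d) (R : realType) (nu : {charge set T -> \bar R}).

(** [charge_pos], [charge_neg] and [charge_abs] are typed as plain measures; these underlying
    expressions carry the finite-measure instances that the previous results require. *)
Local Notation nu_pos := (jordan_pos (hahn_posneg nu)).
Local Notation nu_neg := (jordan_neg (hahn_posneg nu)).
Local Notation nu_abs := (charge_variation (hahn_posneg nu)).

Lemma integral_charge_abs (f : T -> \bar R) : (forall x, 0 <= f x)%E ->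
  measurable_fun setT f -> (\int[charge_abs nu]_x f x =
  \int[charge_pos nu]_x f x + \int[charge_neg nu]_x f x)%E.
Proof.
move=> f0 mf; rewrite -ge0_integral_measure_add//.
by apply: eq_measure_integral => A mA _; rewrite [RHS]measure_addE.
Qed.

Lemma charge_bochner_exists (X : completeNormedModType R) (F : T -> X) :
  strongly_measurable setT F -> (\int[charge_abs nu]_x `|F x|%:E < +oo)%E ->
  exists I, is_charge_bochner_integral nu F I.
Proof.
move=> mF iF; have mnF := strongly_measurable_norm mF.
have iF2 := iF; rewrite integral_charge_abs// in iF2; last exact/measurable_EFinP.
have [Ip hp] : exists I, is_bochner_integral nu_pos F I.
  apply: bochner_integral_exists => //.
  by apply: le_lt_trans iF2; rewrite leeDl// integral_ge0.
have [In hn] : exists I, is_bochner_integral nu_neg F I.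
  apply: bochner_integral_exists => //.
  by apply: le_lt_trans iF2; rewrite leeDr// integral_ge0.
exists (Ip - In); split; last by exists Ip, In.
split=> //; have [s_ [ss sF]] := mF; exists s_; split=> //.
by apply/aeW => x; exact: sF.
Qed.

(** The estimates against the two Jordan parts add up to an integral against the variation. *)
Lemma charge_bochner_dist_le (X : normedModType R) (F G : T -> X) (I J : X) :
  strongly_measurable setT F -> strongly_measurable setT G ->
  is_charge_bochner_integral nu F I -> is_charge_bochner_integral nu G J ->
  (`|I - J|%:E <= \int[charge_abs nu]_x `|F x - G x|%:E)%E.
Proof.
move=> mF mG [_ [Ip [In [hIp hIn ->]]]] [_ [Jp [Jn [hJp hJn ->]]]].
rewrite integral_charge_abs//; last exact: strongly_measurable_dist.
have := leeD (@bochner_integral_dist_le _ _ _ nu_pos _ _ _ _ _ mF mG hIp hJp)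
  (@bochner_integral_dist_le _ _ _ nu_neg _ _ _ _ _ mF mG hIn hJn).
apply: le_trans; rewrite -EFinD lee_fin.
by rewrite opprB (addrC Jn) addrACA (addrC (- In)) -(opprB In) ler_normB.
Qed.

Lemma simple_charge_bochner (X : normedModType R) (s : T -> X) : simple_fun s ->
  is_charge_bochner_integral nu s
    (simple_integral (charge_pos nu) s - simple_integral (charge_neg nu) s).
Proof.
move=> ss; split.
  by have [] := simple_bochner_integral nu_abs ss.
do 2 eexists; split; [| |reflexivity].
  exact: (simple_bochner_integral nu_pos ss).
exact: (simple_bochner_integral nu_neg ss).
Qed.

(** Compare with the zero function, whose integral is 0. *)
Lemma charge_bochner_norm_le (X : normedModType R) (F : T -> X) (I : X) :
  strongly_measurable setT F -> is_charge_bochner_integral nu F I ->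
  (`|I|%:E <= \int[charge_abs nu]_x `|F x|%:E)%E.
Proof.
move=> mF hI; have s0 := simple_map_cst T (0 : X).
have := charge_bochner_dist_le mF (simple_strongly_measurable s0) hI
  (simple_charge_bochner s0).
under eq_integral do rewrite subr0.
have s00 mu' : simple_integral mu' (fun=> 0 : X) = 0 :> X.
  by rewrite /simple_integral fsbig1// => _ [x _ <-]; rewrite scaler0.
by rewrite !s00 !subr0.
Qed.

End charge_bochner_integral.

(** * Translation invariance and the $L^2$ estimate for a convolution *)

Section convolution_estimate.
Context (R : realType).
Local Notation leb := (@lebesgue_measure R).
Local Open Scope ereal_scope.

(** Named so that its measurability can be attached as an instance and Lebesgue measure pushed
    forward along it. *)
Definition translation (c : R) : measurableTypeR R -> measurableTypeR R :=
  fun t => (t + c)%R.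

Lemma measurable_translation c : measurable_fun setT (translation c).
Proof. exact: measurable_funD. Qed.

HB.instance Definition _ c :=
  isMeasurableFun.Build _ _ _ _ (translation c) (measurable_translation c).

(** The pushforward agrees with Lebesgue measure on half-open intervals, which determines it. *)
Lemma lebesgue_measureDr (c : R) (A : set R) : measurable A ->
  pushforward leb (translation c) A = leb A.
Proof.
move=> mA; apply/esym/lebesgue_measure_unique => //= _ [[a b]] _ <-.
rewrite /pushforward.
have -> : translation c @^-1` `]a, b] = `](a - c)%R, (b - c)%R]%classic.
  by apply/seteqP; split=> t; rewrite /= !in_itv/= ltrBlDr lerBrDr.
by rewrite !lebesgue_measure_itv/= !lte_fin ltrD2r -!EFinB opprB addrA addrNK.
Qed.

Lemma ge0_integral_translation (f : R -> \bar R) (c : R) :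
  measurable_fun setT f -> (forall x, 0 <= f x) ->
  \int[leb]_t f (t + c)%R = \int[leb]_t f t.
Proof.
move=> mf f0.
have := ge0_integral_pushforward (measurable_translation c) leb (f := f)
  measurableT mf (fun y _ => f0 y).
rewrite preimage_setT => <-.
by apply: eq_measure_integral => A mA _; exact: lebesgue_measureDr.
Qed.

Lemma poweR2 (x : \bar R) : 0 <= x -> x `^ 2 = x * x.
Proof.
case: x => [x||]//; last by rewrite poweRyr ?mulyy.
by rewrite lee_fin => x0; rewrite poweR_EFin powR_mulrn// expr2 EFinM.
Qed.

Lemma ge0_le_poweR (x y : \bar R) (r : R) :
  (0 <= r)%R -> 0 <= x -> x <= y -> x `^ r <= y `^ r.
Proof.
move=> r0 x0 xy; apply: gt0_ler_poweR => //; rewrite in_itv/= leey andbT//.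
exact: le_trans xy.
Qed.

(** Cauchy-Schwarz against the constant 1, as the case of exponents 2 and 2 in the Hoelder
    inequality. *)
Lemma integral_sqr_le d (S : measurableType d) (mu : {measure set S -> \bar R})
    (f : S -> R) : measurable_fun setT f -> (forall x, 0 <= f x)%R ->
  (\int[mu]_x (f x)%:E) `^ 2 <= mu setT * \int[mu]_x (f x)%:E `^ 2.
Proof.
move=> mf f0.
have n2 : (2 : R)%R != 0%R by [].
have pq : (2^-1 + 2^-1 = 1 :> R)%R by rewrite -[RHS](mulfV n2) mulr2n mulrDl mul1r.
have two0 : (0 < 2 :> R)%R by [].
have m1 : measurable_fun setT (cst 1%R : S -> R) by exact: measurable_cst.
have := hoelder mu mf m1 two0 two0 pq.
rewrite Lnorm1 => le12.
have -> : \int[mu]_x (f x)%:E = \int[mu]_x `|(EFin \o (f \* cst 1)%R) x|.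
  by apply: eq_integral => x _; rewrite /= mulr1 ger0_norm.
apply: (le_trans (ge0_le_poweR (ltW two0) _ le12)).
  by apply: integral_ge0 => x _; exact: abse_ge0.
rewrite poweRM ?Lnorm_ge0// !poweR_Lnorm// muleC.
rewrite (_ : \int[mu]_x _ = mu setT).
  by apply: lee_wpmul2l => //; under eq_integral do rewrite /= ger0_norm//.
under eq_integral do rewrite /= normr1 powR1.
by rewrite integral_cst// mul1e.
Qed.

Section convolution.
Context d (S : measurableType d) (mu : {finite_measure set S -> \bar R}).
Variables (th : S -> R) (mth : measurable_fun setT th).

Lemma measurable_pair (phi : R -> \bar R) : measurable_fun setT phi ->
  measurable_fun setT (fun ts : measurableTypeR R * S => phi (ts.1 - th ts.2)%R).
Proof.
move=> mphi; apply: (measurableT_comp mphi).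
apply: measurable_funB; first exact: measurable_fst.
exact: measurableT_comp.
Qed.

Lemma measurable_convolution (phi : R -> \bar R) : measurable_fun setT phi ->
  (forall x, 0 <= phi x) ->
  measurable_fun setT (fun t : R => \int[mu]_s phi (t - th s)%R).
Proof.
move=> mphi phi0.
exact: (@measurable_fun_fubini_tonelli_F _ _ _ _ _ mu _ (measurable_pair mphi)
  (fun=> phi0 _)).
Qed.

(** One factor [mu setT] comes from Cauchy-Schwarz, the other from integrating over s a quantity
    that translation invariance has made independent of s. *)
Lemma convolution_L2_le (f : R -> R) : measurable_fun setT f ->
  (forall x, 0 <= f x)%R ->
  \int[leb]_t (\int[mu]_s (f (t - th s))%:E) `^ 2 <=
  mu setT `^ 2 * \int[leb]_t (f t)%:E `^ 2.
Proof.
move=> mf f0; pose f2 t := (f t)%:E `^ 2.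
have f20 t : 0 <= f2 t by exact: poweR_ge0.
have mf2 : measurable_fun setT f2.
  by apply: (measurableT_comp (measurable_poweR 2)); exact/measurable_EFinP.
have mt t : measurable_fun setT (fun s => f (t - th s)%R).
  by apply: measurableT_comp => //; exact: measurable_funB.
apply: (@le_trans _ _ (\int[leb]_t (mu setT * \int[mu]_s f2 (t - th s)%R))).
  apply: ge0_le_integralT => t; first exact: poweR_ge0.
  exact: integral_sqr_le.
rewrite ge0_integralZl//; last 2 first.
- exact: measurable_convolution.
- by move=> t _; apply: integral_ge0.
have /= -> := @fubini_tonelli _ _ _ _ _ leb mu _ (measurable_pair mf2) (fun=> f20 _).
under eq_integral do rewrite (ge0_integral_translation (- th _)%R mf2)//.
rewrite integral_cst// muleCA muleC; apply: lee_wpmul2r; first exact: integral_ge0.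
by rewrite poweR2.
Qed.

End convolution.
End convolution_estimate.

(** This is the rounding device for bounded measurable coefficients: the floor takes only integer
    values from -N to N. *)
Lemma simple_map_floor d (T : measurableType d) (R : realType) (c : T -> R) (N : nat) :
  measurable_fun setT c -> (forall x, `|c x| <= N%:R) ->
  simple_map (fun x => Num.floor (c x)).
Proof.
move=> mc cN; split.
  (* The numbers n - N with n <= 2N enumerate the integers from -N to N. *)
  apply: (@sub_finite_set _ _ ((fun n : nat => n%:Z - N%:Z) @` `I_(N + N).+1)).
    move=> _ [x _ <-]; have := cN x; rewrite ler_norml => /andP[Nc cN'].
    have fl : - N%:Z <= Num.floor (c x) by rewrite floor_ge_int_tmp intrN.
    have fu : Num.floor (c x) <= N%:Z by rewrite -(ler_int R) (le_trans (floor_le_tmp _)).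
    have fl' : 0 <= Num.floor (c x) + N%:Z by rewrite -lerBlDr sub0r.
    exists (absz (Num.floor (c x) + N%:Z)); last by rewrite gez0_abs// addrK.
    by rewrite /= ltnS -lez_nat gez0_abs// PoszD lerD2r.
  exact/finite_image/finite_II.
move=> z; rewrite (_ : _ @^-1` _ = c @^-1` `[z%:~R, (z + 1)%:~R[).
  by rewrite -[X in measurable X]setTI; exact: mc.
apply/seteqP; split=> x /=; rewrite in_itv/=; last exact: floor_def.
by move=> <-; exact: floor_itv.
Qed.

(** * Existence and estimates of the convolution with sigma *)

Section delay_convolution_theory.
Context (R : realType) (X : normedModType R) (Y : completeNormedModType R).
Context (tau : R) (tau_gt0 : 0 < tau).
Variables (A : X -> Y) (L : R) (sigma : {charge set (delay_itv tau_gt0) -> \bar R}).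
Hypothesis L0 : 0 <= L.
Hypothesis A0 : A 0 = 0.
Hypothesis A_lip : forall u v, `|A u - A v| <= L * `|u - v|.
Implicit Types G H : R -> X.

Local Notation leb := (@lebesgue_measure R).
Local Notation mu := (charge_variation (hahn_posneg sigma)).
Local Notation K := (delay_conv A sigma).
Local Notation exK := (delay_conv_exists A sigma).

(** The scalar majorant phi: its finiteness at t guarantees that the integral defining [K G t]
    exists. *)
Definition norm_conv G (t : R) : \bar R :=
  (\int[charge_abs sigma]_s `|G (t - delay_val s)|%:E)%E.

Let A_continuous : continuous A.
Proof.
move=> v; apply/cvgrPdist_le => e e0.
(* L may be 0, so the division is by L + 1. *)
have L1 : 0 < L + 1 by rewrite ltr_wpDl.
near=> u; rewrite (le_trans (A_lip _ _))//.
rewrite (@le_trans _ _ ((L + 1) * (e / (L + 1))))//; last first.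
  by rewrite mulrC divfK ?gt_eqF.
rewrite ler_pM// ?lerDl//; near: u.
by apply: cvgr_dist_le; [exact: cvg_id|rewrite divr_gt0].
Unshelve. all: by end_near. Qed.

Lemma measurable_delay_val : measurable_fun setT (@delay_val R tau tau_gt0).
Proof. by move=> _ B mB; rewrite setTI; exists B; rewrite ?setTI. Qed.

Let measurable_delay t :
  measurable_fun setT (fun s : delay_itv tau_gt0 => t - delay_val s).
Proof. by apply: measurable_funB => //; exact: measurable_delay_val. Qed.

Lemma strongly_measurable_delay G t : strongly_measurable setT G ->
  strongly_measurable setT (fun s : delay_itv tau_gt0 => G (t - delay_val s)).
Proof. by move=> mG; exact: (strongly_measurable_precomp (measurable_delay t)). Qed.

Lemma strongly_measurable_delay_integrand G t : strongly_measurable setT G ->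
  strongly_measurable setT (@delay_integrand R X Y tau tau_gt0 A G t).
Proof.
move=> mG; apply: (strongly_measurable_comp A_continuous).
exact: strongly_measurable_delay.
Qed.

Let norm_A v : `|A v| <= L * `|v|.
Proof. by have := A_lip v 0; rewrite A0 !subr0. Qed.

Lemma norm_conv_ge0 G t : (0 <= norm_conv G t)%E.
Proof. exact: integral_ge0. Qed.

Lemma measurable_norm_conv G : strongly_measurable setT G ->
  measurable_fun setT (norm_conv G).
Proof.
move=> mG; apply: (@measurable_convolution _ _ _ mu _ measurable_delay_val
  (fun t => `|G t|%:E)) => //.
exact/measurable_EFinP/strongly_measurable_norm.
Qed.

Lemma norm_conv_L2_le G : strongly_measurable setT G ->
  (\int[leb]_t (norm_conv G t) `^ 2 <=
   (charge_abs sigma setT) `^ 2 * \int[leb]_t `|G t|%:E `^ 2)%E.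
Proof.
move=> mG; apply: (@convolution_L2_le _ _ _ mu _ measurable_delay_val
  (fun t => `|G t|)) => //.
exact: strongly_measurable_norm.
Qed.

(** Since sigma has finite variation, the $L^2$ estimate makes the square of phi integrable, hence
    finite almost everywhere; the square of +oo is +oo. *)
Lemma norm_conv_ae_fin G : strongly_measurable setT G ->
  (\int[leb]_t `|G t|%:E `^ 2 < +oo)%E -> {ae leb, forall t, (norm_conv G t < +oo)%E}.
Proof.
move=> mG iG.
have : leb.-integrable setT (fun t => (norm_conv G t) `^ 2)%E.
  apply/integrableP; split.
    by apply: (measurableT_comp (measurable_poweR 2)); exact: measurable_norm_conv.
  under eq_integral do rewrite gee0_abs ?poweR_ge0//.
  apply: (le_lt_trans (norm_conv_L2_le mG)).
  rewrite lte_mul_pinfty ?poweR_ge0// poweR2 ?measure_ge0//.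
  by rewrite fin_numM// (fin_num_measure mu).
move=> /(integrable_ae measurableT); apply: filterS => t /(_ Logic.I).
have := norm_conv_ge0 G t; case: (norm_conv G t) => [r _ _|_|//]; first exact: ltry.
by rewrite poweRyr.
Qed.

Lemma norm_conv_ae_eq0 G : strongly_measurable setT G ->
  (\int[leb]_t `|G t|%:E `^ 2 = 0)%E -> {ae leb, forall t, norm_conv G t = 0%E}.
Proof.
move=> mG iG.
have mG2 : measurable_fun setT (fun t => (norm_conv G t) `^ 2)%E.
  by apply: (measurableT_comp (measurable_poweR 2)); exact: measurable_norm_conv.
have : (\int[leb]_t `|(norm_conv G t) `^ 2| = 0)%E.
  apply/le_anti/andP; split; last exact: integral_ge0.
  under eq_integral do rewrite gee0_abs ?poweR_ge0//.
  by apply: (le_trans (norm_conv_L2_le mG)); rewrite iG mule0.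
move=> /(ae_eq_integral_abs leb measurableT mG2).1; apply: filterS => t /(_ Logic.I) /=.
by move=> /poweR_eq0_eq0; apply; exact: norm_conv_ge0.
Qed.

Lemma integral_delay_integrand_le G t : strongly_measurable setT G ->
  (\int[mu]_s `|@delay_integrand R X Y tau tau_gt0 A G t s|%:E <=
   L%:E * norm_conv G t)%E.
Proof.
move=> mG; rewrite /norm_conv -ge0_integralZl//; last first.
  exact/measurable_EFinP/strongly_measurable_norm/strongly_measurable_delay.
apply: ge0_le_integralT => s; first by rewrite lee_fin.
by rewrite -EFinM lee_fin norm_A.
Qed.

Lemma delay_conv_existsP G t : strongly_measurable setT G ->
  (norm_conv G t < +oo)%E -> exK G t.
Proof.
move=> mG iG; apply: charge_bochner_exists.
  exact: strongly_measurable_delay_integrand.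
apply: le_lt_trans (integral_delay_integrand_le t mG) _.
by rewrite lte_mul_pinfty ?lee_fin.
Qed.

Lemma delay_convP G t : exK G t ->
  is_charge_bochner_integral sigma (@delay_integrand R X Y tau tau_gt0 A G t) (K G t).
Proof. by move=> [I hI]; apply: (xgetPex 0); exists I. Qed.

Lemma delay_conv_dist_le G H t : strongly_measurable setT G ->
  strongly_measurable setT H -> exK G t -> exK H t ->
  (`|K G t - K H t|%:E <= L%:E * norm_conv (fun t => G t - H t)%R t)%E.
Proof.
move=> mG mH /delay_convP eG /delay_convP eH.
apply: (le_trans (charge_bochner_dist_le (strongly_measurable_delay_integrand t mG)
  (strongly_measurable_delay_integrand t mH) eG eH)).
rewrite /norm_conv -ge0_integralZl//; last first.
  apply: strongly_measurable_dist; exact: strongly_measurable_delay.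
apply: ge0_le_integralT => s; first by rewrite lee_fin.
by rewrite -EFinM lee_fin A_lip.
Qed.

(** The bound holds at every t: where the integral does not exist, [K G t] has the default value
    0. *)
Lemma delay_conv_norm_le G t : strongly_measurable setT G ->
  (`|K G t|%:E <= L%:E * norm_conv G t)%E.
Proof.
move=> mG; have [/delay_convP eG|eG] := pselect (exK G t).
  apply: le_trans (integral_delay_integrand_le t mG).
  exact: charge_bochner_norm_le (strongly_measurable_delay_integrand t mG) eG.
rewrite /delay_conv /charge_bochner_integral xgetPN => [|I hI].
  by rewrite normr0 mule_ge0 ?lee_fin ?norm_conv_ge0.
by apply: eG; exists I.
Qed.


(** * Strong measurability of the convolution, by way of simple functions *)

Let fibre (s : R -> X) y t : set (delay_itv tau_gt0) :=
  (fun r => s (t - delay_val r)) @^-1` [set y].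

Let measurable_fibre s y t : simple_fun s -> measurable (fibre s y t).
Proof. by move=> ss; exact: (simple_map_precomp (measurable_delay t) ss).2. Qed.

Let measurable_measure_fibre (nu : {finite_measure set (delay_itv tau_gt0) -> \bar R})
    s y : simple_fun s -> measurable_fun setT (fun t => fine (nu (fibre s y t))).
Proof.
move=> ss; apply: (measurableT_comp (fine_measurable measurableT)).
rewrite (_ : (fun t => _) =
    (fun t => \int[nu]_r (\1_(s @^-1` [set y]) (t - delay_val r))%:E)%E).
  apply: (measurable_convolution nu measurable_delay_val
    (phi := fun t => (\1_(s @^-1` [set y]) t)%:E)) => //.
  by apply/measurable_EFinP/measurable_indic; exact: ss.2.
apply/funext => t; rewrite -[fibre s y t]setIT -integral_indic//.
exact: measurable_fibre.
Qed.

(** The value of sigma on the fibre, as a real number: the coefficient of [A y] in the convolution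
    of s at t. *)
Let coef s y t : R := fine (charge_pos sigma (fibre s y t)) -
  fine (charge_neg sigma (fibre s y t)).

Let measurable_coef s y : simple_fun s -> measurable_fun setT (coef s y).
Proof.
move=> ss; apply: measurable_funB.
  exact: (measurable_measure_fibre (jordan_pos (hahn_posneg sigma))).
exact: (measurable_measure_fibre (jordan_neg (hahn_posneg sigma))).
Qed.

Let fine_fibre_le (nu : {finite_measure set (delay_itv tau_gt0) -> \bar R}) s y t :
  simple_fun s -> fine (nu (fibre s y t)) <= fine (nu setT).
Proof.
move=> ss; have mF := measurable_fibre y t ss.
by rewrite fine_le ?fin_num_measure// le_measure ?inE.
Qed.

Let coef_le s y t : simple_fun s ->
  `|coef s y t| <= fine (charge_pos sigma setT) + fine (charge_neg sigma setT).
Proof.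
move=> ss; rewrite (le_trans (ler_normB _ _))// lerD// ger0_norm ?fine_ge0//.
  exact: (fine_fibre_le (jordan_pos (hahn_posneg sigma))).
exact: (fine_fibre_le (jordan_neg (hahn_posneg sigma))).
Qed.

(** Summing over the whole range of s keeps the index set and the vectors [A y] independent of t;
    only the coefficients vary. *)
Let simple_delay_conv s t : simple_fun s ->
  is_charge_bochner_integral sigma (@delay_integrand R X Y tau tau_gt0 A s t)
    (\sum_(y <- fset_set (range s)) coef s y t *: A y).
Proof.
move=> ss.
have st : simple_map (fun r : delay_itv tau_gt0 => s (t - delay_val r)).
  exact: (simple_map_precomp (measurable_delay t) ss).
have sr (r : delay_itv tau_gt0) : s (t - delay_val r) \in fset_set (range s).
  exact: simple_map_fset.
have := simple_charge_bochner sigma (simple_map_comp A st).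
rewrite (@simple_integral_comp _ _ _ (charge_pos sigma)
  (fin_num_measure (jordan_pos (hahn_posneg sigma))) _ _ _ _ _ st sr).
rewrite (@simple_integral_comp _ _ _ (charge_neg sigma)
  (fin_num_measure (jordan_neg (hahn_posneg sigma))) _ _ _ _ _ st sr).
by rewrite -sumrB; under eq_bigr do rewrite -scalerBl.
Qed.

(* The convolution of a simple function is a finite sum of vectors with bounded
   measurable coefficients; rounding the coefficients makes it simple. *)
Let simple_delay_conv_approx s (e : R) : simple_fun s -> 0 < e ->
  exists2 u : R -> Y, simple_fun u & forall t,
    `|\sum_(y <- fset_set (range s)) coef s y t *: A y - u t| <= e.
Proof.
move=> ss e0; set r := fset_set _.
(* With mesh h = e / c the total error is at most h times the sum of the norms, hence at most e; the
   summand 1 keeps c positive. *)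
pose c := 1 + \sum_(y <- r) `|A y|.
have c0 : 0 < c by rewrite ltr_pwDl// sumr_ge0.
pose h := e / c; have h0 : 0 < h by rewrite divr_gt0.
pose k y t := Num.floor (coef s y t / h).
exists (fun t => \sum_(y <- r) (h * (k y t)%:~R) *: A y).
  apply: simple_map_sum => y.
  apply: (simple_map_comp (fun z : int => (h * z%:~R) *: A y)).
  pose M := (fine (charge_pos sigma setT) + fine (charge_neg sigma setT)) / h.
  apply: (@simple_map_floor _ _ _ _ (Num.bound M)).
    by apply: measurable_funM => //; exact: measurable_coef.
  move=> t; rewrite normrM normfV (gtr0_norm h0).
  apply: (@le_trans _ _ M); first by rewrite ler_wpM2r ?invr_ge0 ?(ltW h0)// coef_le.
  by rewrite ltW// archi_boundP// divr_ge0 ?(ltW h0)// addr_ge0 ?fine_ge0.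
move=> t; rewrite -sumrB; under eq_bigr do rewrite -scalerBl.
rewrite (le_trans (ler_norm_sum _ _ _))//.
apply: (@le_trans _ _ (\sum_(y <- r) h * `|A y|)).
  apply: ler_sum => y _; rewrite normrZ ler_wpM2r//.
  (* By the floor inequalities h k <= coef < h k + h, so each coefficient moves by at most h. *)
  have /andP[] := floor_itv (coef s y t / h).
  rewrite -/(k y t) ler_pdivlMr// ltr_pdivrMr// intrD mulrDl mul1r mulrC => kl ku.
  by rewrite ger0_norm ?subr_ge0// lerBlDl mulrC ltW// mulrC.
rewrite -mulr_sumr /h -mulrA ler_piMr ?(ltW e0)//.
by rewrite mulrC ler_pdivrMr// mul1r lerDr.
Qed.

(** With simple [s_ n] tending to G, [u_ n] is a simple function within 1 / (n + 1) of [K (s_ n)].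
    Wherever phi is finite, dominated convergence in s gives [K (s_ n) t] tending to [K G t]. *)
Lemma delay_conv_approx G : strongly_measurable setT G ->
  exists u_ : nat -> R -> Y, (forall n, simple_fun (u_ n)) /\
    forall t, (norm_conv G t < +oo)%E -> u_ n t @[n --> \oo] --> K G t.
Proof.
move=> mG; have [s_ [ss sG1 sG]] := strongly_measurable_approx mG.
have ainv n : 0 < n.+1%:R^-1 :> R by rewrite invr_gt0.
pose u_ n := sval (cid2 (simple_delay_conv_approx (ss n) (ainv n))).
have us n : simple_fun (u_ n) by rewrite /u_; case: cid2.
have uw n t : `|\sum_(y <- fset_set (range (s_ n))) coef (s_ n) y t *: A y - u_ n t| <=
  n.+1%:R^-1 by rewrite /u_; case: cid2.
exists u_; split=> // t Gt.
have ms n := simple_strongly_measurable (ss n).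
have /delay_convP eG : exK G t by exact: delay_conv_existsP.
have Gs := @dist_integral_cvg0 _ _ _ mu _ _ _ (strongly_measurable_delay t mG) Gt
  (fun n => strongly_measurable_delay t (ms n)) (fun n r => sG1 n _) (fun r => sG _).
have bnd n : (`|K G t - u_ n t|%:E <= L%:E * \int[mu]_r
    `|G (t - delay_val r) - s_ n (t - delay_val r)|%:E + (n.+1%:R^-1)%:E)%E.
  set w := \sum_(y <- fset_set (range (s_ n))) coef (s_ n) y t *: A y.
  apply: (@le_trans _ _ (`|K G t - w|%:E + `|w - u_ n t|%:E)%E).
    by rewrite -EFinD lee_fin -(subrKA w) ler_normD.
  apply: leeD; last by rewrite lee_fin uw.
  apply: (le_trans (charge_bochner_dist_le (strongly_measurable_delay_integrand t mG)
    (strongly_measurable_delay_integrand t (ms n)) eG (simple_delay_conv t (ss n)))).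
  rewrite -ge0_integralZl//; last first.
    apply: strongly_measurable_dist; exact: strongly_measurable_delay.
  apply: ge0_le_integralT => r; first by rewrite lee_fin.
  by rewrite -EFinM lee_fin A_lip.
apply/cvgrPdist_le => e e0.
have : (L%:E * \int[mu]_r `|G (t - delay_val r) - s_ n (t - delay_val r)|%:E +
    (n.+1%:R^-1)%:E)%E @[n --> \oo] --> 0%E.
  rewrite -[X in _ --> X]adde0; apply: cvgeD => //.
    by rewrite -[X in _ --> X](mule0 L%:E); exact: cvgeZl.
  by apply/cvg_EFin; [exact/nearW|exact: cvg_harmonic].
have e0' : (0 < e%:E)%E by rewrite lte_fin.
move=> /(_ _ (open_ereal_lt' e0'))[N _ HN]; exists N => // n /HN /= ne.
by rewrite -lee_fin (le_trans (bnd n))// ltW.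
Qed.

Lemma delay_conv_L2_le G : strongly_measurable setT G ->
  (\int[leb]_t `|K G t|%:E `^ 2 <=
   (L%:E * charge_abs sigma setT) `^ 2 * \int[leb]_t `|G t|%:E `^ 2)%E.
Proof.
move=> mG; rewrite poweRM ?lee_fin// -muleA.
apply: le_trans (lee_wpmul2l (poweR_ge0 _ _) (norm_conv_L2_le mG)).
rewrite -ge0_integralZl//; last 3 first.
- by apply: (measurableT_comp (measurable_poweR 2)); exact: measurable_norm_conv.
- by move=> t _; exact: poweR_ge0.
- exact: poweR_ge0.
apply: ge0_le_integralT => t; first exact: poweR_ge0.
rewrite -poweRM ?lee_fin ?norm_conv_ge0//.
by apply: ge0_le_poweR; rewrite ?lee_fin ?delay_conv_norm_le.
Qed.

(** The function phi of G - H vanishes almost everywhere by the $L^2$ estimate, and where both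
    integrals exist it controls their distance. *)
Lemma delay_conv_ae_eq G H : strongly_measurable setT G ->
  strongly_measurable setT H -> {ae leb, forall t, G t = H t} ->
  {ae leb, forall t, exK G t} -> {ae leb, forall t, exK H t} ->
  {ae leb, forall t, K G t = K H t}.
Proof.
move=> mG mH GH eG eH.
have : {ae leb, forall t, norm_conv (fun t => G t - H t) t = 0%E}.
  apply: norm_conv_ae_eq0; first exact: strongly_measurableB.
  rewrite -(integral0 leb setT); apply: ae_ge0_eq_integralT => [t|t|].
  - exact: poweR_ge0.
  - by [].
  - by apply: aeS GH => t ->; rewrite subrr normr0 poweR0r.
have eGH : {ae leb, forall t, exK G t /\ exK H t} by apply: aeS2 eG eH.
move=> nc; apply: aeS2 nc eGH => t GH0 [eGt eHt].
have := delay_conv_dist_le mG mH eGt eHt.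
by rewrite GH0 mule0 lee_fin normr_le0 subr_eq0 => /eqP.
Qed.

End delay_convolution_theory.

(** * Lebesgue measure carried by an open interval *)

Section lebesgue_interval.
Context (R : realType) (a b : R).
Local Notation leb := (@lebesgue_measure R).
Local Notation itv := (lebesgue_itv a b).
Local Notation D := (`]a, b[%classic : set R).
Local Open Scope ereal_scope.

Lemma lebesgue_itv_le A : measurable A -> itv A <= leb A.
Proof.
move=> mA; apply: le_measure; rewrite ?inE//.
by apply: measurableI => //; exact: measurable_itv.
Qed.

Lemma ae_lebesgue_itv (P : R -> Prop) :
  {ae leb, forall t, P t} -> {ae itv, forall t, P t}.
Proof.
move=> [N [mN N0 PN]]; exists N; split=> //.
by apply/le_anti; rewrite measure_ge0 andbT -N0 lebesgue_itv_le.
Qed.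

Lemma ae_lebesgue_itvP (P : R -> Prop) :
  {ae itv, forall t, P t} -> {ae leb, forall t, D t -> P t}.
Proof.
move=> [N [mN N0 PN]]; exists (N `&` D); split => //.
  by apply: measurableI => //; exact: measurable_itv.
by move=> t /= /not_implyP[Dt Pt]; split=> //; exact: PN.
Qed.

Lemma ae_lebesgue_itv_in : {ae itv, forall t, D t}.
Proof.
exists (~` D); split=> //; first by apply: measurableC; exact: measurable_itv.
by rewrite -[LHS]/(leb (~` D `&` D)) setICl measure0.
Qed.

Lemma integral_lebesgue_itv (f : R -> \bar R) : (forall t, ~ D t -> f t = 0) ->
  \int[leb]_t f t = \int[itv]_t f t.
Proof.
(* For extended reals the value of [f \_ D] off D is 0, so f is its own restriction. *)
move=> fD; have fE : f = f \_ D.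
  by apply/funext => t; rewrite patchE; case: ifPn => // /negP; rewrite inE => /fD.
rewrite fE -!integral_mkcond; apply: eq_measure_integral => A mA AD.
by rewrite -[RHS]/(leb (A `&` D)) setIidl.
Qed.

End lebesgue_interval.

(** * The $L^2$ norm and the delay operator on $L^2(-\tau,T;V)$ *)

Lemma L2normE d (T : measurableType d) (R : realType) (X : normedModType R)
    (mu : {measure set T -> \bar R}) (F : T -> X) :
  L2norm mu F = ((\int[mu]_x `|F x|%:E `^ 2) `^ 2^-1)%E.
Proof.
rewrite /L2norm unlock; congr poweR.
by apply: eq_integral => x _; rewrite /= ger0_norm.
Qed.

Theorem lemma2p3 (R : realType) (T tau : R) (T_gt0 : 0 < T) (tau_gt0 : 0 < tau)
    (V : hilbertType R) (V_separable : separable_space V)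
    (a1 : {biscalar V}) (Lambda1 : R) (Lambda1_gt0 : 0 < Lambda1)
    (a1_bounded : forall w v : V, `|a1 w v| <= Lambda1 * `|w| * `|v|)
    (sigma : {charge set (delay_itv tau_gt0) -> \bar R})
    (g : R -> V) (g_L2 : bochner_L2 (lebesgue_itv (- tau) T) g) :
  let A1 : V -> tdual V := form_op a1_bounded in
  let K : (R -> V) -> R -> tdual V := delay_conv A1 sigma in
  let ext (h : R -> V) : R -> V := zero_ext (- tau) T h in
  (exists h, borel_representative (- tau) T g h) /\
  forall h, borel_representative (- tau) T g h ->
    [/\ {ae lebesgue_itv 0 T, forall t, delay_conv_exists A1 sigma (ext h) t},
        bochner_L2 (lebesgue_itv 0 T) (K (ext h)),
        (L2norm (lebesgue_itv 0 T) (K (ext h)) <=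
          Lambda1%:E * charge_abs sigma setT * L2norm (lebesgue_itv (- tau) T) g)%E,
        forall h', borel_representative (- tau) T g h' ->
          K (ext h') = K (ext h) %[ae lebesgue_itv 0 T] &
        forall gm : R -> V, strongly_measurable setT gm ->
          gm = ext h %[ae lebesgue_measure] ->
          {ae lebesgue_itv 0 T, forall t, delay_conv_exists A1 sigma gm t} /\
          K gm = K (ext h) %[ae lebesgue_itv 0 T]].
Proof.
move=> A1 K ext.
have L0 : 0 <= Lambda1 by exact: ltW.
have A1B u v : A1 u - A1 v = A1 (u - v).
  by rewrite /A1 -scaleN1r addrC -form_op_linear addrC scaleN1r.
have A1_lip u v : `|A1 u - A1 v| <= Lambda1 * `|u - v|.
  by rewrite A1B; exact: form_op_norm.
have A10 : A1 0 = 0 by rewrite -(subrr (0 : V)) -A1B subrr.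
have mD : measurable (`]- tau, T[%classic : set R) by exact: measurable_itv.
have sm_ext h : borel_representative (- tau) T g h -> strongly_measurable setT (ext h).
  by move=> [mh _]; exact: strongly_measurable_patch.
have ext_g h : borel_representative (- tau) T g h ->
    {ae lebesgue_itv (- tau) T, forall t, ext h t = g t}.
  move=> [_ hg]; apply: aeS2 hg (ae_lebesgue_itv_in (- tau) T) => t /(_ Logic.I) <- Dt.
  by rewrite /ext /zero_ext /patch mem_set.
have ext_L2 h : borel_representative (- tau) T g h ->
    (\int[lebesgue_measure]_t `|ext h t|%:E `^ 2 =
     \int[lebesgue_itv (- tau) T]_t `|g t|%:E `^ 2)%E.
  move=> hg; rewrite (@integral_lebesgue_itv _ (- tau) T); last first.
    by move=> t Dt; rewrite /ext /zero_ext /patch memNset// normr0 poweR0r.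
  apply: ae_ge0_eq_integralT => [t|t|]; try exact: poweR_ge0.
  by apply: aeS (ext_g _ hg) => t ->.
have gfin : (\int[lebesgue_itv (- tau) T]_t `|g t|%:E `^ 2 < +oo)%E.
  (* An infinite integral would have an infinite square root, against the finiteness of the norm of
     g. *)
  have := g_L2.2; rewrite L2normE; case: integral => [r|//|]; rewrite ?ltry ?ltNyr//.
  by rewrite poweRyr.
split.
  (* The representative is g set to 0 on a measurable null set N containing all points of
     non-convergence; the simple functions cut off in the same way converge everywhere. *)
  have [s_ [ss [N [mN N0 sN]]]] := g_L2.1.
  exists (patch (fun=> 0) (~` N) g); split.
    exists (fun n => patch (fun=> 0) (~` N) (s_ n)); split=> [n|t _].
      by apply: (simple_map_patch 0 _ (ss n)); exact: measurableC.
    rewrite /patch; case: ifPn => [tN|_]; last exact: cvg_cst.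
    by apply: contrapT => sg; move/set_mem: tN; apply; exact: sN.
  exists N; split=> // t /=; apply: contra_notP => tN _.
  by rewrite /patch mem_set.
move=> h hg.
have mG := sm_ext _ hg.
have Gfin : (\int[lebesgue_measure]_t `|ext h t|%:E `^ 2 < +oo)%E by rewrite ext_L2.
have nG := norm_conv_ae_fin sigma mG Gfin.
have exG : {ae lebesgue_measure, forall t, delay_conv_exists A1 sigma (ext h) t}.
  by apply: aeS nG => t; exact: (delay_conv_existsP L0 A10 A1_lip mG).
have KL2 : (L2norm (lebesgue_itv 0 T) (K (ext h)) <=
    Lambda1%:E * charge_abs sigma setT * L2norm (lebesgue_itv (- tau) T) g)%E.
  have LM0 : (0 <= Lambda1%:E * charge_abs sigma setT)%E by rewrite mule_ge0 ?lee_fin.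
  rewrite !L2normE -(ext_L2 _ hg).
  set LM := (_ * _)%E in LM0 *.
  (* The constant is written as the root of its square, so that both sides become square roots and
     the squared estimate applies. *)
  have LME : LM = ((LM `^ 2) `^ 2^-1)%E by rewrite -poweRrM mulfV// poweRe1.
  rewrite [X in (_ <= X * _)%E]LME.
  rewrite -poweRM ?poweR_ge0//; last by apply: integral_ge0 => t _; exact: poweR_ge0.
  have le2 := delay_conv_L2_le sigma L0 A10 A1_lip mG.
  apply: ge0_le_poweR; first by rewrite invr_ge0.
    by apply: integral_ge0 => t _; exact: poweR_ge0.
  (* The integral over ]0, T[ is bounded by the one over the whole line. *)
  apply: le_trans le2; apply: le_measure_ge0_integralT => [S mS|t].
    exact: lebesgue_itv_le.
  exact: poweR_ge0.
have indep gm : strongly_measurable setT gm -> gm = ext h %[ae lebesgue_measure] ->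
    {ae lebesgue_itv 0 T, forall t, delay_conv_exists A1 sigma gm t} /\
    K gm = K (ext h) %[ae lebesgue_itv 0 T].
  move=> mgm gmh.
  have gmh' : {ae lebesgue_measure, forall t, gm t = ext h t}.
    by apply: aeS gmh => t /(_ Logic.I).
  have gmfin : (\int[lebesgue_measure]_t `|gm t|%:E `^ 2 < +oo)%E.
    rewrite (_ : (\int[_]_t _)%E = (\int[lebesgue_measure]_t `|ext h t|%:E `^ 2)%E)//.
    apply: ae_ge0_eq_integralT => [t|t|]; try exact: poweR_ge0.
    by apply: aeS gmh' => t ->.
  have exgm : {ae lebesgue_measure, forall t, delay_conv_exists A1 sigma gm t}.
    apply: aeS (norm_conv_ae_fin sigma mgm gmfin) => t.
    exact: (delay_conv_existsP L0 A10 A1_lip mgm).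
  split; first exact: ae_lebesgue_itv exgm.
  apply: aeS (ae_lebesgue_itv 0 T (delay_conv_ae_eq L0 A1_lip mgm mG gmh' exgm exG)).
  by move=> t Kt _; exact: Kt.
split=> //.
- exact: ae_lebesgue_itv exG.
- split.
    have [u_ [us uK]] := delay_conv_approx sigma L0 A10 A1_lip mG.
    exists u_; split=> //; apply: ae_lebesgue_itv; apply: aeS nG => t; exact: uK.
  apply: (le_lt_trans KL2); rewrite lte_mul_pinfty//.
  + by rewrite mule_ge0 ?lee_fin.
  + by rewrite fin_numM// (fin_num_measure (charge_variation (hahn_posneg sigma))).
  + exact: g_L2.2.
(* Two representatives are a case of modification on a null set of the line: their extensions agree
   almost everywhere on ]-tau, T[ and are both 0 outside. *)
move=> h' h'g; apply: (indep _ (sm_ext _ h'g) _).2.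
have hh' : {ae lebesgue_itv (- tau) T, forall t, ext h' t = ext h t}.
  by apply: aeS2 (ext_g _ hg) (ext_g _ h'g) => t -> ->.
apply: aeS (ae_lebesgue_itvP hh') => t hh't _.
have [/set_mem/hh't//|tD] := boolP (t \in (`]- tau, T[%classic : set R)).
by rewrite /ext /zero_ext /patch (negbTE tD).
Qed.
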